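(* Let $u$ be the exact solution of $\partial_tu=Lu$, let $u_h(t)$ be the solution of the semidiscrete scheme $\partial_tu_h=L_hu_h$ with $u_h(0)\in V_h$, and let $u_h^{n+1}=R_s(\tau L_h)u_h^n$ be the fully discrete scheme. Suppose the assumptions (R), (SB), (FS), (RK) and (M) listed in the context hold, and $u_h^0=\Pi u(0)$. Then for every $n\ge0$ $$\|u(t^n)-u_h^n\|\le e^{\max(\mu,\mu_h)t^n}\big(\|u_h(0)-\Pi u(0)\|+\|\Pi u(0)-u_h^0\|+C_\star\tau^p\big)+E(t^n,h),$$ where $C_\star=C_\Pi\Big(e+\sum_{i=p+1}^s|\alpha_i|\Big)\sigma(\mu_h,t^n)$.
   Context: Setting. $\Omega\subset\mathbb{R}^d$ and $V=L^2(\Omega;\mathbb{R}^m)$ with inner product $\langle\cdot,\cdot\rangle$ and norm $\|\cdot\|$. $L=\sum_{|\alpha|\le q}a_\alpha(x)D^\alpha$ is a linear differential operator of order $q$ in $x$. $u:\Omega\times[0,\infty)\to\mathbb{R}^m$ satisfies $\partial_tu=Lu$; $u(t)=u(\cdot,t)\in V$. $V_h\subset V$ is a finite-dimensional subspace, $L_h:V_h\to V_h$ is linear, with operator norm $\|L_h\|$. $R_s(\tau L_h)=\sum_{i=0}^s\alpha_i(\tau L_h)^i$ with real constants $\alpha_i$; $t^n=n\tau$. Standing conventions: $\tau\le1$, $\tau\|L_h\|\le\lambda<1$. $\Pi$ is a linear operator mapping sufficiently smooth functions of $x$ into $V_h$. For $a\ge0$: $\sigma(a,t)=(e^{at}-1)/a$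 if $a>0$, $\sigma(0,t)=t$. (R) $u$ is sufficiently smooth, such that $\partial_t^iu$, $L^iu$ ($1\le i\le p+1$) and $\Pi\partial_t^iu(\cdot,t)$ ($0\le i\le p+1$) are well-defined and bounded in $L^\infty$ norm, and $\partial_t^iu=L^iu$ for $1\le i\le p+1$. (SB) There is a constant $\mu\ge0$ with $\langle L_hv_h,v_h\rangle\le\mu\|v_h\|^2$ for all $v_h\in V_h$. (FS) There is a constant $\mu_h\ge0$ such that $\|R_s(\tau L_h)\|\le1+\mu_h\tau$ for all time steps $\tau>0$ with $\tau\|L_h\|\le\lambda$. (RK) $p\ge1$, $\alpha_i=1/i!$ for $0\le i\le p$, and $\alpha_{p+1}\ne1/(p+1)!$ (with $\alpha_i=0$ for $i>s$). (M) $\|u(t)-u_h(t)\|\le E(t,h)$ for all $t\ge 0$; and $\Pi u(0)\in V_h$ satisfies $\|L_h^{p+1}\Pi u(0)\|\le C_\Pi$. *)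

(* Defs.v *)
From HB Require Import structures.
From mathcomp Require Import all_boot all_order all_algebra.
From mathcomp Require Import all_classical all_reals all_analysis.
Set Implicit Arguments. Unset Strict Implicit. Unset Printing Implicit Defensive.
Import Order.TTheory GRing.Theory Num.Theory.
Import numFieldNormedType.Exports.
From mathcomp Require Import ring lra.
Local Open Scope classical_set_scope.
Local Open Scope ring_scope.

(* The Borel sigma-algebra of R^d, generated by the coordinate functions (it
   contains the open sets by open_measurable_rV). *)
Section borel_rV.
Context {R : realType} (d : nat).

Let coor (i : 'I_d) (x : 'rV[R]_d) : measurableTypeR R := x ord0 i.

Let rV_set0 : g_sigma_preimage coor set0.
Proof. exact: sigma_algebra0. Qed.

Let rV_setC A : g_sigma_preimage coor A -> g_sigma_preimage coor (~` A).
Proof. exact: sigma_algebraC. Qed.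

Let rV_bigcup (F : _^nat) : (forall i, g_sigma_preimage coor (F i)) ->
  g_sigma_preimage coor (\bigcup_i (F i)).
Proof. exact: sigma_algebra_bigcup. Qed.

HB.instance Definition _ := @isMeasurable.Build default_measure_display
  'rV[R]_d (g_sigma_preimage coor) rV_set0 rV_setC rV_bigcup.

Lemma measurable_coor (i : 'I_d) :
  measurable_fun [set: 'rV[R]_d] (fun x : 'rV[R]_d => x ord0 i).
Proof.
move=> _ Y mY; rewrite setTI; apply: sub_sigma_algebra => /=.
rewrite -bigcup_seq/=; exists i => /=; first by rewrite mem_index_enum.
by exists Y => //; rewrite setTI.
Qed.

Lemma measurable_fun_rV dT (T : measurableType dT) (f : T -> 'rV[R]_d) :
  (forall i, measurable_fun [set: T] (fun t => f t ord0 i)) ->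
  measurable_fun [set: T] f.
Proof.
move=> mf _ Y; rewrite setTI => mY.
have : g_sigma_preimage coor `<=` image_set_system setT f measurable.
  apply: smallest_sub.
    apply: sigma_algebra_image; exact: sigma_algebra_measurable.
  case: d @coor f mf => [|n] coor' f mf; first by rewrite big_ord0.
  rewrite -bigcup_mkord_ord. apply: bigcup_sub => i Ii. move=> A [B mB <-].
  by rewrite /image_set_system/= !setTI -[X in measurable X]setTI; exact: mf.
by move=> /(_ _ mY); rewrite /image_set_system/= setTI.
Qed.

Lemma open_measurable_rV (A : set 'rV[R]_d) : open A -> measurable A.
Proof.
move=> oA.
pose box (c : 'rV[rat]_d * nat) : set 'rV[R]_d :=
  [set x | forall i, `|x ord0 i - ratr (c.1 ord0 i)| < c.2.+1%:R^-1].
have mbox c : measurable (box c).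
  rewrite (_ : box c = \bigcap_(i in [set: 'I_d])
      (fun x : 'rV[R]_d => x ord0 i) @^-1`
      [set y | `|y - ratr (c.1 ord0 i)| < c.2.+1%:R^-1]).
    apply: fin_bigcap_measurable => // i _.
    rewrite -[X in measurable X]setTI; apply: measurable_coor => //.
    rewrite (_ : [set y | _] = ball (ratr (c.1 ord0 i) : R) c.2.+1%:R^-1).
      apply: (@measurable_realfun.open_measurable R); exact: ball_open.
    by apply/seteqP; split => y /=; rewrite -ball_normE/= distrC.
  by apply/seteqP; split=> x /= h i; [move=> _|]; exact: h.
pose B c := if `[< box c `<=` A >] then box c else set0.
rewrite (_ : A = \bigcup_c B c).
  apply: countable_bigcupT_measurable; first exact: countableP.
  by move=> c; rewrite /B; case: ifP.
apply/seteqP; split => [x Ax|x [c _]]; last first.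
  by rewrite /B; case: asboolP => // cA bx; exact: cA.
have /nbhs_ballP[e /= e0 xeA] : nbhs x A by exact: open_nbhs_nbhs.
have [n] := ltr_add_invr (divr_gt0 e0 (ltr0Sn R 1)); rewrite add0r.
set r := n.+1%:R^-1 => re.
have r0 : 0 < r by rewrite invr_gt0.
have hq i : exists q : rat, `|x ord0 i - ratr q| < r.
  have [|q] := @rat_in_itvoo R (x ord0 i - r) (x ord0 i + r).
    by rewrite ltrBlDr -addrA ltrDl addr_gt0.
  by rewrite in_itv/= => /andP[q1 q2]; exists q; rewrite distrC ltr_distl q1.
have /choice[q qr] := hq.
exists (\row_i q i, n) => //; rewrite /B; case: asboolP => [_|].
  by move=> i; rewrite mxE; exact: qr.
case=> y /= by_; apply: xeA; rewrite mx_norm_ball /ball_/= [ltLHS]mx_normrE.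
apply/bigmax_ltP; split => // -[i j] _ /=; rewrite !mxE (ord1 i).
have := by_ j; rewrite mxE => yj.
rewrite -(subrKA (ratr (q j))) (le_lt_trans (ler_normD _ _))//.
by rewrite (splitr e) ltrD// ?(lt_trans _ re)// distrC.
Qed.

End borel_rV.

Section lebesgue_rV.
Context {R : realType}.

Definition rV_cons (d : nat) (p : measurableTypeR R * 'rV[R]_d) : 'rV[R]_(1 + d) :=
  row_mx (p.1 : R)%:M p.2.

Lemma measurable_rV_cons (d : nat) : measurable_fun setT (@rV_cons d).
Proof.
apply: measurable_fun_rV => i; rewrite /rV_cons.
case: (split_ordP i) => [j ->|j ->].
- under eq_fun do rewrite row_mxEl mxE (ord1 j) eqxx mulr1n.
  exact: measurable_fst.
- under eq_fun do rewrite row_mxEr.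
  apply: (@measurableT_comp _ _ _ _ _ _ (fun x : 'rV[R]_d => x ord0 j)) => //.
  exact: measurable_coor.
Qed.

Section step.
Variables (d : nat) (mu : {sigma_finite_measure set 'rV[R]_d -> \bar R}).

(* The product of the Lebesgue measure of R and of a measure of R^d,
   transported from R * R^d to R^(1 + d). *)
Definition lebesgue_rV_cons : set 'rV[R]_(1 + d) -> \bar R :=
  pushforward (lebesgue_measure \x mu)%E (@rV_cons d).

Let m0 : lebesgue_rV_cons set0 = 0%E.
Proof. by rewrite /lebesgue_rV_cons /pushforward preimage_set0 measure0. Qed.

Let m_ge0 A : (0 <= lebesgue_rV_cons A)%E.
Proof. by rewrite /lebesgue_rV_cons /pushforward measure_ge0. Qed.

Let m_sigma_additive : semi_sigma_additive lebesgue_rV_cons.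
Proof.
move=> F mF tF mUF; rewrite /lebesgue_rV_cons /pushforward preimage_bigcup.
apply: measure_semi_sigma_additive.
- by move=> n; rewrite -[X in measurable X]setTI; exact: measurable_rV_cons.
- apply/trivIsetP => /= i j _ _ ij; rewrite -preimage_setI.
  by move/trivIsetP : tF => /(_ _ _ _ _ ij) ->//; rewrite preimage_set0.
- rewrite -preimage_bigcup -[X in measurable X]setTI.
  exact: measurable_rV_cons.
Qed.

HB.instance Definition _ :=
  isMeasure.Build _ _ _ lebesgue_rV_cons m0 m_ge0 m_sigma_additive.

Let m_sigma_finite : sigma_finite setT lebesgue_rV_cons.
Proof.
have /sigma_finiteP[F [FT ndF mF]] := sigma_finiteT (@lebesgue_measure R).
have /sigma_finiteP[G [GT ndG mG]] := sigma_finiteT mu.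
pose uncons (x : 'rV[R]_(1 + d)) : measurableTypeR R * 'rV[R]_d :=
  (lsubmx x ord0 ord0, rsubmx x).
exists (fun n => uncons @^-1` (F n `*` G n)).
  apply/esym; rewrite -subTset => x _.
  have [n _ Fn] : (\bigcup_i F i) (uncons x).1 by rewrite -FT.
  have [k _ Gk] : (\bigcup_i G i) (uncons x).2 by rewrite -GT.
  exists (maxn n k) => //; split.
  - by move: Fn; exact/subsetPset/ndF/leq_maxl.
  - by move: Gk; exact/subsetPset/ndG/leq_maxr.
move=> n; have [mFn Fnoo] := mF n; have [mGn Gnoo] := mG n.
have mu_uncons : measurable_fun setT uncons.
  apply/measurable_fun_pair.
    by under eq_fun do rewrite mxE; exact: measurable_coor.
  apply: measurable_fun_rV => i.
  by under eq_fun do rewrite mxE; exact: measurable_coor.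
split.
  rewrite -[X in measurable X]setTI; apply: mu_uncons => //.
  exact: measurableX.
rewrite /lebesgue_rV_cons /pushforward -comp_preimage.
rewrite (_ : _ \o _ = id); last first.
  apply/funext => -[a b] /=.
  by rewrite /uncons /rV_cons/= row_mxKl row_mxKr mxE eqxx mulr1n.
by rewrite product_measure1E// lte_mul_pinfty// ge0_fin_numE.
Qed.

HB.instance Definition _ :=
  Measure_isSigmaFinite.Build _ _ _ lebesgue_rV_cons m_sigma_finite.

End step.

Fixpoint lebesgue_rV (d : nat) : {sigma_finite_measure set 'rV[R]_d -> \bar R} :=
  if d is d'.+1 return {sigma_finite_measure set 'rV[R]_d -> \bar R}
  then lebesgue_rV_cons (lebesgue_rV d')
  else \d_(0 : 'rV[R]_0).

End lebesgue_rV.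

Definition lebesgue_on {R : realType} (d : nat) (Omega : set 'rV[R]_d)
    (oOmega : open Omega) : {measure set 'rV[R]_d -> \bar R} :=
  mrestr (lebesgue_rV d) (open_measurable_rV oOmega).

(* L^2(mu; R^m): square-integrable functions modulo equality mu-almost
   everywhere, with norm Num.sqrt (L2_dot u u). *)
Section L2_space.
Local Open Scope quotient_scope.
Context {disp : measure_display} {T : measurableType disp} {R : realType}.
Variables (mu : {measure set T -> \bar R}) (m : nat).

Definition L2_pred : {pred T -> 'cV[R]_m} :=
  [pred f : T -> 'cV[R]_m | `[< forall j, (fun x => f x j ord0) \in Lfun mu 2%:E >]].

Let L2_submod : submod_closed L2_pred.
Proof.
have h : submod_closed (Lfun mu (2%:E : \bar R)).
  by apply: Lfun_submod_closed; rewrite lee1n.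
split.
  apply/asboolP => j; rewrite (_ : (fun _ => _) = 0); first by case: h.
  by apply/funext => x; rewrite mxE.
move=> a f g /asboolP Hf /asboolP Hg; apply/asboolP => j.
rewrite (_ : (fun _ => _) =
  a *: (fun x => f x j ord0) + (fun x => g x j ord0) :> (T -> R)).
  by case: h => _; apply.
by apply/funext => x; rewrite !fctE !mxE.
Qed.

HB.instance Definition _ := GRing.isSubmodClosed.Build R _ L2_pred L2_submod.

Record L2_fun := MkL2_fun { L2_val :> T -> 'cV[R]_m ; _ : L2_val \in L2_pred }.

HB.instance Definition _ := [isSub of L2_fun for L2_val].
HB.instance Definition _ := [Choice of L2_fun by <:].
HB.instance Definition _ := [SubChoice_isSubLmodule of L2_fun by <:].

Definition L2_null : {pred L2_fun} :=
  [pred f : L2_fun | `[< {ae mu, forall x, f x = 0} >]].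

Let L2_null_submod : submod_closed L2_null.
Proof.
split; first by apply/asboolP; apply: aeW.
move=> a f g /asboolP f0 /asboolP g0; apply/asboolP.
by apply: filterS2 f0 g0 => x /= fx gx; rewrite !fctE fx gx scaler0 addr0.
Qed.

HB.instance Definition _ := GRing.isSubmodClosed.Build R _ L2_null L2_null_submod.

Definition L2 : Type := Quotient.quot L2_null.

HB.instance Definition _ := GRing.Zmodule.on L2.
HB.instance Definition _ := EqQuotient.on L2.


Lemma L2_eqP (f g : L2_fun) :
  \pi_L2 f = \pi_L2 g <-> {ae mu, forall x, f x = g x}.
Proof.
have -> : (\pi_L2 f = \pi_L2 g) <-> (f - g \in L2_null).
  by split => [/eqP|fg]; [|apply/eqP]; rewrite -Quotient.idealrBE.
split=> [/asboolP fg|fg]; [|apply/asboolP]; apply: filterS fg => x /=;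
  rewrite !fctE; [by move/eqP; rewrite subr_eq0 => /eqP|by move->; rewrite subrr].
Qed.

Lemma L2_repr_pi (f : L2_fun) : {ae mu, forall x, repr (\pi_L2 f) x = f x}.
Proof. by apply/L2_eqP; rewrite reprK. Qed.

Lemma L2_reprD (u v : L2) :
  {ae mu, forall x, repr (u + v) x = repr u x + repr v x}.
Proof.
by have := L2_repr_pi (repr u + repr v); rewrite raddfD/= !reprK.
Qed.

Definition L2_scale (a : R) (u : L2) : L2 := \pi_L2 (a *: repr u).

Lemma L2_scaleE a (f : L2_fun) : L2_scale a (\pi_L2 f) = \pi_L2 (a *: f).
Proof.
by apply/L2_eqP; apply: filterS (L2_repr_pi f) => x /=; rewrite !fctE => ->.
Qed.

Let L2_scaleA a b u : L2_scale a (L2_scale b u) = L2_scale (a * b) u.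
Proof. by rewrite -[u]reprK !L2_scaleE reprK scalerA. Qed.

Let L2_scale1 : left_id 1 L2_scale.
Proof. by move=> u; rewrite -[u]reprK !L2_scaleE scale1r. Qed.

Let L2_scaleDr : right_distributive L2_scale +%R.
Proof.
move=> a u v; rewrite -[u]reprK -[v]reprK -raddfD !L2_scaleE scalerDr.
by rewrite raddfD.
Qed.

Let L2_scaleDl u : {morph L2_scale^~ u : a b / a + b}.
Proof. by move=> a b; rewrite -[u]reprK !L2_scaleE scalerDl raddfD. Qed.

HB.instance Definition _ := GRing.Zmodule_isLmodule.Build R L2
  L2_scaleA L2_scale1 L2_scaleDr L2_scaleDl.

Lemma L2_reprZ (a : R) (u : L2) : {ae mu, forall x, repr (a *: u) x = a *: repr u x}.
Proof. exact: L2_repr_pi. Qed.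

Definition L2_dot (u v : L2) : R :=
  \int[mu]_x \sum_(j < m) repr u x j ord0 * repr v x j ord0.

Let L2_fun_comp (f : L2_fun) j : (fun x => f x j ord0) \in Lfun mu 2%:E.
Proof. by case: f => f /= /asboolP. Qed.

Lemma L2_integrable (f g : L2_fun) : mu.-integrable setT
  (EFin \o (fun x => \sum_(j < m) f x j ord0 * g x j ord0)).
Proof.
rewrite (_ : _ \o _ =
    fun x => (\sum_(j < m) (f x j ord0 * g x j ord0)%:E)%E); last first.
  by apply/funext => x; rewrite /= sumEFin.
apply: integrable_sum => // j _.
by apply/Lfun1_integrable/Lfun2_mul_Lfun1; exact: L2_fun_comp.
Qed.

Lemma L2_dot_ae (u v : L2) (f g : L2_fun) :
  {ae mu, forall x, repr u x = f x} -> {ae mu, forall x, repr v x = g x} ->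
  L2_dot u v = \int[mu]_x \sum_(j < m) f x j ord0 * g x j ord0.
Proof.
move=> uf vg; rewrite /L2_dot /Rintegral; congr fine.
apply: ae_eq_integral => //.
- by case/integrableP: (L2_integrable (repr u) (repr v)).
- by case/integrableP: (L2_integrable f g).
- by apply: filterS2 uf vg => x -> ->.
Qed.

Lemma L2_dotC u v : L2_dot u v = L2_dot v u.
Proof.
by apply: eq_Rintegral => x _; apply: eq_bigr => j _; rewrite mulrC.
Qed.

Lemma L2_dotDl u v w : L2_dot (u + v) w = L2_dot u w + L2_dot v w.
Proof.
rewrite (L2_dot_ae (f := repr u + repr v) (g := repr w) (L2_reprD u v)) //; last exact: aeW.
rewrite -RintegralD //; try exact: L2_integrable.
apply: eq_Rintegral => x _; rewrite -big_split; apply: eq_bigr => j _.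
by rewrite /= !fctE mxE mulrDl.
Qed.

Lemma L2_dotZl a u w : L2_dot (a *: u) w = a * L2_dot u w.
Proof.
rewrite (L2_dot_ae (f := a *: repr u) (g := repr w) (L2_reprZ a u)) //; last exact: aeW.
rewrite -RintegralZl //; try exact: L2_integrable.
apply: eq_Rintegral => x _; rewrite mulr_sumr; apply: eq_bigr => j _.
by rewrite /= !fctE mxE mulrA.
Qed.

Lemma L2_dot_ge0 u : 0 <= L2_dot u u.
Proof.
by apply: Rintegral_ge0 => x _; apply: sumr_ge0 => j _; rewrite -expr2 sqr_ge0.
Qed.

Lemma L2_dot_eq0 u : L2_dot u u = 0 -> u = 0.
Proof.
move=> u0; rewrite -[u]reprK -[0]reprK; apply/L2_eqP.
pose F x := \sum_(j < m) repr u x j ord0 * repr u x j ord0.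
have F0 x : 0 <= F x by apply: sumr_ge0 => j _; rewrite -expr2 sqr_ge0.
have iF : mu.-integrable setT (EFin \o F) by exact: L2_integrable.
have mF := measurable_int _ iF.
have F_0 : ae_eq mu setT (EFin \o F) (cst 0%E).
  apply/(ae_eq_integral_abs mu measurableT mF).
  rewrite (eq_integral (EFin \o F)); last by move=> x _; rewrite gee0_abs// lee_fin.
  rewrite -[LHS]fineK; last exact: integral_fune_fin_num.
  by congr EFin; exact: u0.
have z : {ae mu, forall x, repr (0 : L2) x = 0}.
  by have := L2_repr_pi 0; rewrite raddf0.
apply: filterS2 F_0 z => x /(_ Logic.I)/= [] Fx ->.
apply/colP => j; rewrite mxE; apply/eqP.
have /psumr_eq0P : \sum_(j < m) repr u x j ord0 * repr u x j ord0 = 0 by [].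
have h i : true -> 0 <= repr u x i ord0 * repr u x i ord0.
  by rewrite -expr2 sqr_ge0.
by move=> /(_ h j isT)/eqP; rewrite mulf_eq0 orbb.
Qed.

Definition L2_represents (u : L2) (f : T -> 'cV[R]_m) : Prop :=
  {ae mu, forall x, repr u x = f x}.

Definition L2_norm (u : L2) : R := Num.sqrt (L2_dot u u).

Let L2_dotDr u v w : L2_dot u (v + w) = L2_dot u v + L2_dot u w.
Proof. by rewrite L2_dotC L2_dotDl !(L2_dotC _ u). Qed.

Let L2_dotZr a u w : L2_dot u (a *: w) = a * L2_dot u w.
Proof. by rewrite L2_dotC L2_dotZl L2_dotC. Qed.

Lemma L2_cauchy_schwarz u v : L2_dot u v <= L2_norm u * L2_norm v.
Proof.
have [v0|v0] := eqVneq (L2_dot v v) 0.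
  by rewrite (L2_dot_eq0 v0) -(scale0r 0) L2_dotZr mul0r mulr_ge0 ?sqrtr_ge0.
have {}v0 : 0 < L2_dot v v by rewrite lt_neqAle eq_sym v0 L2_dot_ge0.
apply: le_trans (ler_norm _) _.
rewrite /L2_norm -sqrtrM ?L2_dot_ge0// -sqrtr_sqr ler_wsqrtr//.
have := L2_dot_ge0 (L2_dot v v *: u + (- L2_dot u v) *: v).
rewrite !(L2_dotDl, L2_dotDr, L2_dotZl, L2_dotZr) (L2_dotC v u).
set a := L2_dot u u; set b := L2_dot v v in v0 *; set c := L2_dot u v.
have -> : b * (b * a) + b * (- c * c) + (- c * (b * c) + - c * (- c * b)) =
  b * (a * b - c ^+ 2) by ring.
by rewrite pmulr_rge0// subr_ge0.
Qed.

Let L2_normD u v : L2_norm (u + v) <= L2_norm u + L2_norm v.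
Proof.
rewrite -(@ler_pXn2r _ 2) ?nnegrE ?addr_ge0 ?sqrtr_ge0//.
rewrite sqrrD !sqr_sqrtr ?L2_dot_ge0// !(L2_dotDl, L2_dotDr) (L2_dotC v u).
rewrite addrA lerD2r -addrA lerD2l -mulr2n ler_wMn2r//.
exact: L2_cauchy_schwarz.
Qed.

Let L2_normZ a u : L2_norm (a *: u) = `|a| * L2_norm u.
Proof.
by rewrite /L2_norm L2_dotZl L2_dotZr mulrA -expr2 sqrtrM ?sqr_ge0// sqrtr_sqr.
Qed.

Let L2_norm_eq0 u : L2_norm u = 0 -> u = 0.
Proof.
move=> /eqP; rewrite sqrtr_eq0 => u0; apply: L2_dot_eq0.
by apply/eqP; rewrite eq_le u0 L2_dot_ge0.
Qed.

HB.instance Definition _ :=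
  Lmodule_isNormed.Build R L2 L2_normD L2_normZ L2_norm_eq0.

Lemma L2_normE (u : L2) : `|u| = Num.sqrt (L2_dot u u).
Proof. by []. Qed.

End L2_space.

Section time_derivative.
Context {R : realType} {W : normedModType R}.
Implicit Types (f : R -> W) (t : R).

(* Derivatives of functions of t in [0, +oo[, hence one-sided at t = 0 *)
Definition time_quotient f t : R -> W := fun s => (s - t)^-1 *: (f s - f t).

Definition time_derivable f t : Prop :=
  cvg (time_quotient f t @ within [set s | 0 <= s] t^').

Definition time_derive f t : W :=
  lim (time_quotient f t @ within [set s | 0 <= s] t^').

Definition time_derive_n (i : nat) f : R -> W := iter i time_derive f.

End time_derivative.

(* A function on an open set Omega is given by a total function, of which only
   the values on Omega matter. *)
Section differential_operator.
Context {R : realType} {d m : nat}.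
Implicit Types (v : 'rV[R]_d -> 'cV[R]_m) (Omega : set 'rV[R]_d).

Definition partial (i : 'I_d) v : 'rV[R]_d -> 'cV[R]_m :=
  'D_(delta_mx ord0 i) v.

Definition class_C (k : nat) Omega v : Prop :=
  forall l : seq 'I_d, (size l <= k)%N -> forall x, Omega x ->
    {for x, continuous (foldr partial v l)} /\
    ((size l < k)%N -> forall i,
      derivable (foldr partial v l) x (delta_mx ord0 i)).

Definition multi_partial {q : nat} (alpha : {ffun 'I_d -> 'I_q.+1}) v :=
  foldr (fun i => iter (alpha i) (partial i)) v (enum 'I_d).

(* The multi-indices alpha with |alpha| <= q have all components <= q. *)
Definition diff_op {q : nat}
    (a : {ffun 'I_d -> 'I_q.+1} -> 'rV[R]_d -> 'M[R]_m) v :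
    'rV[R]_d -> 'cV[R]_m :=
  fun x => \sum_(alpha : {ffun 'I_d -> 'I_q.+1} | (\sum_i alpha i <= q)%N)
    a alpha x *m multi_partial alpha v x.

End differential_operator.

(* Boundedness in L^oo(Omega; R^m), uniformly on bounded time intervals *)
Definition Linfty_bounded {R : realType} (d m : nat)
    (mu : {measure set 'rV[R]_d -> \bar R})
    (f : R -> 'rV[R]_d -> 'cV[R]_m) : Prop :=
  forall t1 : R, exists M : R, forall t, 0 <= t <= t1 ->
    (Lnorm mu +oo (fun x => `|f t x|%:E) <= M%:E)%E.

Section discrete_space.
Context {R : realType}.

Definition finite_dimensional (W : lmodType R) : Prop :=
  exists (n : nat) (b : 'I_n -> W),
    forall w, exists c : 'I_n -> R, w = \sum_(i < n) c i *: b i.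

Definition opnorm {V : normedModType R} {S : {pred V}} {W : subLmodType S}
    (A : W -> W) : \bar R :=
  ereal_sup [set (`|\val (A w)|)%:E | w in [set w : W | `|\val w| <= 1]].

(* R_s(tau A) = sum_(0 <= i <= s) alpha_i (tau A)^i *)
Definition rk_op {W : lmodType R} (alpha : nat -> R) (s : nat) (tau : R)
    (A : W -> W) (w : W) : W :=
  \sum_(i < s.+1) alpha i *: iter i (fun z => tau *: A z) w.

Definition growth_sigma (a t : R) : R :=
  if 0 < a then (expR (a * t) - 1) / a else t.

End discrete_space.

Section assumptions.
Context {R : realType} {d m : nat} {Omega : set 'rV[R]_d}.
Local Notation field := ('rV[R]_d -> 'cV[R]_m).

(* A linear operator Pi defined on a space dom of functions of class C^k on
   Omega; its total extension outside dom is irrelevant. *)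
Record smooth_linear_operator (k : nat) (dom : set field) {W : lmodType R}
    (Pi : field -> W) : Prop := {
  dom_smooth : dom `<=` class_C k Omega ;
  dom_zero : dom 0 ;
  dom_linear : forall (c : R) f g, dom f -> dom g -> dom (c *: f + g) ;
  dom_ext : forall f g, (forall x, Omega x -> f x = g x) -> dom f -> dom g ;
  op_ext : forall f g, (forall x, Omega x -> f x = g x) -> dom f -> Pi f = Pi g ;
  op_linear : forall (c : R) f g, dom f -> dom g ->
    Pi (c *: f + g) = c *: Pi f + Pi g }.

Definition exact_solution (L : field -> field)
    (u : 'rV[R]_d -> R -> 'cV[R]_m) : Prop :=
  forall x t, Omega x -> 0 <= t ->
    time_derivable (u x) t /\ time_derive (u x) t = L (u ^~ t) x.

(* reg_Lt expresses that L, of order q, can be applied p + 1 times to u(t). *)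
Record regular_solution (oOmega : open Omega) (q p : nat)
    (L : field -> field) (dom : set field)
    {S : {pred L2 (lebesgue_on oOmega) m}} {W : subLmodType S}
    (Pi : field -> W) (u : 'rV[R]_d -> R -> 'cV[R]_m) : Prop := {
  reg_dt : forall i x t, (i <= p)%N -> Omega x -> 0 <= t ->
    time_derivable (time_derive_n i (u x)) t ;
  reg_Lt : forall i t, (i <= p)%N -> 0 <= t ->
    class_C q Omega (iter i L (u ^~ t)) ;
  reg_Pi : forall i t, (i <= p.+1)%N -> 0 <= t ->
    dom (fun x => time_derive_n i (u x) t) ;
  reg_dt_bounded : forall i, (1 <= i <= p.+1)%N ->
    Linfty_bounded (lebesgue_on oOmega)
      (fun t x => time_derive_n i (u x) t) ;
  reg_Lt_bounded : forall i, (1 <= i <= p.+1)%N ->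
    Linfty_bounded (lebesgue_on oOmega) (fun t => iter i L (u ^~ t)) ;
  reg_Pi_bounded : forall i, (i <= p.+1)%N ->
    Linfty_bounded (lebesgue_on oOmega)
      (fun t => repr (\val (Pi (fun x => time_derive_n i (u x) t)))) ;
  reg_eq : forall i x t, (1 <= i <= p.+1)%N -> Omega x -> 0 <= t ->
    time_derive_n i (u x) t = iter i L (u ^~ t) x }.

End assumptions.
Arguments smooth_linear_operator {R d m} Omega k dom {W} Pi.
Arguments exact_solution {R d m} Omega L u.
Arguments regular_solution {R d m Omega} oOmega q p L dom {S W} Pi u.

(* Main.v *)
Require Import Defs.
From HB Require Import structures.
From mathcomp Require Import all_boot all_order all_algebra.
From mathcomp Require Import all_classical all_reals all_analysis.
From mathcomp Require Import ring lra.
Set Implicit Arguments. Unset Strict Implicit. Unset Printing Implicit Defensive.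
Import Order.TTheory GRing.Theory Num.Theory.
Import numFieldNormedType.Exports.
Local Open Scope classical_set_scope.
Local Open Scope ring_scope.

(** The error is split at two intermediate objects: the given semidiscrete
    solution [uh], compared with the exact solution by the hypothesis on [E],
    and the semidiscrete solution [y] that starts from the projected initial
    value [Pi u(0)], which is also where the fully discrete scheme starts.

    The difference [uh - y] solves the same linear equation as [uh], so the
    one-sided bound [<L w, w> <= mu |w|^2] propagates its initial size with the
    factor [exp (mu t)] ([semidiscrete_stability], an energy estimate).

    The difference between [y] and the Runge-Kutta iterates [v] obeys
    [y(t + tau) - v^(n+1) = R_s (y t - v^n) + rho], where [rho] is the defect of
    one step applied to [y]. The order conditions make the first [p + 1] terms
    of [R_s] the Taylor polynomial of [y], whence, as [tau |L| <= 1],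
    [|rho| <= (e + sum_(i > p) |alpha_i|) tau^(p+1) |L^(p+1) y(t)|]
    ([rk_consistency]). The constant [e] bounds the growth of [y] within one
    step. Since [L^(p+1) y] is again a semidiscrete solution, its norm at time
    [t] is at most [exp (mu t) |L^(p+1) Pi u(0)|]: the
    bound [C_Pi] at time 0 controls all the defects. Adding up the [n] defects, each amplified by
    at most [exp (max mu mu_h * t^n)], gives a factor [n tau = t^n]
    ([rk_convergence]), which is at most [sigma (mu_h, t^n)].

    The curve [y] is built in coordinates with respect to a generating family
    of the finite-dimensional space, by the power series of the exponential
    ([exists_flow]). The calculus of curves in [V] is reduced to real functions
    by pairing with the inner product. *)

(** * Curves in a normed space *)

Section curves.
Context {R : realType} {V : normedModType R}.
Implicit Types (f g : R -> V) (t r s : R).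

Lemma is_derive1P f t df :
  is_derive t 1 f df <-> h^-1 *: (f (h + t) - f t) @[h --> 0^'] --> df.
Proof.
have E : (fun h : R => h^-1 *: ((f \o shift t) (h *: 1) - f t)) =
    fun h => h^-1 *: (f (h + t) - f t).
  by apply/funext => h /=; rewrite [h *: 1]mulr1.
split=> [[]|fdf]; first by rewrite /derivable /derive E => + <-.
split; first by rewrite /derivable E; exact: cvgP fdf.
by rewrite /derive E; exact: cvg_lim fdf.
Qed.

Lemma is_derive_scalel (c : R -> R) (dc : R) (v : V) t : is_derive t 1 c dc ->
  is_derive t 1 (fun s => c s *: v) (dc *: v).
Proof.
move=> [dc1 dc2]; apply/is_derive1P.
under eq_fun do rewrite -scalerBl scalerA.
apply: cvgZr_tmp.
move: dc1; rewrite /derivable (_ : (fun h : R => _) =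
    fun h => h^-1 * (c (h + t) - c t)) => [dc1|]; last first.
  by apply/funext => h /=; rewrite [h *: 1]mulr1.
rewrite -dc2 /derive; under [in X in _ --> X]eq_fun do rewrite /= [_ *: 1]mulr1.
exact: dc1.
Qed.

Lemma is_derive1_shift f t (a : R) df :
  is_derive (t + a) 1 f df -> is_derive t 1 (fun s => f (s + a)) df.
Proof.
move=> /is_derive1P fdf; apply/is_derive1P; by under eq_fun do rewrite -addrA.
Qed.

Lemma is_derive1_continuous f t df : is_derive t 1 f df ->
  f s @[s --> t] --> f t.
Proof. by case=> /derivable1_diffP/differentiable_continuous. Qed.

Lemma time_derive_cvg f t l : time_derivable f t /\ time_derive f t = l ->
  time_quotient f t @ within [set s | 0 <= s] t^' --> l.
Proof. by case=> + <-. Qed.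

(** At positive times the constraint [0 <= s] is void near [t], so the one-sided
    derivative is the ordinary one. *)
Lemma time_derive_is_derive1 f t l : 0 < t ->
  time_derivable f t /\ time_derive f t = l -> is_derive t 1 f l.
Proof.
move=> t0 /time_derive_cvg fl; apply/is_derive1P.
rewrite (_ : (fun _ => _) = time_quotient f t \o shift t); last first.
  by apply/funext => h; rewrite /time_quotient /= addrK.
apply: cvg_comp fl => A; rewrite /within /= => /nbhs_ballP[e /= e0 eA].
apply/nbhs_ballP; exists (Num.min e t) => /=; first by rewrite lt_min e0.
move=> h; rewrite /ball /= sub0r normrN lt_min => /andP[he ht] h0.
apply: eA => /=.
- by rewrite /ball /= opprD addrCA subrr addr0 normrN.
- by rewrite -subr_eq0 addrK.
- by move: ht; rewrite ltr_norml => /andP[+ _]; lra.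
Qed.

(** With the equation at positive times, this is what the energy estimate asks
    of a semidiscrete solution. *)
Lemma time_derive_cvg0 f l : time_derivable f 0 /\ time_derive f 0 = l ->
  f t @[t --> 0^'+] --> f 0.
Proof.
move=> /time_derive_cvg fl.
have {}fl : s^-1 *: (f s - f 0) @[s --> 0^'+] --> l.
  rewrite (_ : (fun _ => _) = time_quotient f 0); last first.
    by apply/funext => h; rewrite /time_quotient /= subr0.
  apply: cvg_trans fl; apply: cvg_fmap2 => A; rewrite /within /=.
  move=> /nbhs_ballP[e /= e0 eA]; apply/nbhs_ballP; exists e => //= h eh h0.
  by apply: eA => //=; rewrite ?gt_eqF// ltW.
have id0 : (id : R -> R) s @[s --> 0^'+] --> (0 : R).
  by apply: cvg_at_right_filter; exact: cvg_id.
have sD : ((s : R) *: (s^-1 *: (f s - f 0)) + f 0 : V) @[s --> (0 : R)^'+] --> f 0.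
  rewrite -[X in _ --> X]add0r -(scale0r l); apply: cvgD; last exact: cvg_cst.
  by apply: cvgZ.
apply: cvg_trans sD; apply: near_eq_cvg; near=> s => /=.
have s0 : 0 < s by near: s; exact: nbhs_right_gt.
by rewrite scalerA divff ?gt_eqF// scale1r subrK.
Unshelve. all: by end_near. Qed.

End curves.

(** * Calculus with an inner product *)

Record inner_product {R : realType} {V : normedModType R} (dot : V -> V -> R) := {
  dotDl : forall u v w, dot (u + v) w = dot u w + dot v w ;
  dotZl : forall c u v, dot (c *: u) v = c * dot u v ;
  dotC : forall u v, dot u v = dot v u ;
  dotE : forall u, dot u u = `|u| ^+ 2 }.

Section calculus.
Context {R : realType} {V : normedModType R} {dot : V -> V -> R}.
Hypothesis ip : inner_product dot.
Implicit Types (f g : R -> V) (t r s : R).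

Lemma dotDr u v w : dot w (u + v) = dot w u + dot w v.
Proof. by rewrite (dotC ip) (dotDl ip) !(dotC ip _ w). Qed.

Lemma dotZr c u v : dot v (c *: u) = c * dot v u.
Proof. by rewrite (dotC ip) (dotZl ip) (dotC ip _ v). Qed.

Lemma dotNr u v : dot u (- v) = - dot u v.
Proof. by rewrite -scaleN1r dotZr mulN1r. Qed.

Lemma dotNl u v : dot (- u) v = - dot u v.
Proof. by rewrite (dotC ip) dotNr (dotC ip). Qed.

(** Cauchy-Schwarz, by expanding the square of [|v| u - |u| v]. *)
Lemma dot_le u v : dot u v <= `|u| * `|v|.
Proof.
have [->|u0] := eqVneq u 0.
  by rewrite -(scale0r 0) (dotZl ip) mul0r mulr_ge0.
have [->|v0] := eqVneq v 0.
  by rewrite -(scale0r 0) dotZr mul0r mulr_ge0.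
have uv0 : 0 < `|u| * `|v| by rewrite mulr_gt0 ?normr_gt0.
have := sqr_ge0 (`| `|v| *: u - `|u| *: v |).
rewrite -(dotE ip) !(dotDl ip, dotDr, dotNl, dotNr, dotZl ip, dotZr) !(dotE ip).
rewrite (dotC ip v u) => uv.
rewrite -subr_ge0 -(pmulr_rge0 _ uv0) -(pmulr_rge0 _ (ltr0Sn R 1)).
by apply: le_trans uv _; rewrite le_eqVlt; apply/orP; left; apply/eqP; ring.
Qed.

(** Makes the pairing continuous without any estimate, the norm being
    continuous. *)
Lemma dot_polarization u v : dot u v = 4^-1 * (`|u + v| ^+ 2 - `|u - v| ^+ 2).
Proof.
rewrite -!(dotE ip) !(dotDl ip, dotDr, dotNl, dotNr) (dotC ip v u).
move: (dot u u) (dot u v) (dot v v) => a b c; by field.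
Qed.

Lemma cvg_dot (T : Type) (F : set_system T) (FF : Filter F) (f g : T -> V) u v :
  f x @[x --> F] --> u -> g x @[x --> F] --> v ->
  dot (f x) (g x) @[x --> F] --> dot u v.
Proof.
move=> fu gv; rewrite dot_polarization; under eq_fun do rewrite dot_polarization.
have sq (e : T -> V) w : e x @[x --> F] --> w ->
    `|e x| ^+ 2 @[x --> F] --> `|w| ^+ 2.
  move=> ew; rewrite expr2; under eq_fun do rewrite expr2.
  by apply: cvgM; apply: cvg_norm.
by apply: cvgM; [exact: cvg_cst|apply: cvgB; apply: sq; [exact: cvgD|exact: cvgB]].
Qed.

Lemma is_derive_dot f g t df dg : is_derive t 1 f df -> is_derive t 1 g dg ->
  is_derive t 1 (fun s => dot (f s) (g s)) (dot df (g t) + dot (f t) dg).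
Proof.
move=> fdf gdg; apply/is_derive1P.
rewrite (_ : (fun _ => _) = fun h => dot (h^-1 *: (f (h + t) - f t)) (g (h + t))
    + dot (f t) (h^-1 *: (g (h + t) - g t))); last first.
  apply/funext => h; rewrite (dotZl ip) dotZr -mulrDr; congr (_ * _).
  by rewrite (dotDl ip) dotNl dotDr dotNr addrA subrK.
apply: cvgD; apply: cvg_dot.
- exact/is_derive1P.
- have /= gt := is_derive1_continuous gdg.
  apply: (cvg_comp (fun h : R => h + t) g) gt.
  have h0 : ((h : R) + t : R) @[h --> (0 : R)] --> t.
    by rewrite -[X in _ --> X]add0r; apply: cvgD; [exact: cvg_id|exact: cvg_cst].
  apply: cvg_trans h0; apply: cvg_fmap2; exact: cvg_within.
- exact: cvg_cst.
- exact/is_derive1P.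
Qed.

(** The real mean value theorem applied to the curve paired with its own
    increment. *)
Lemma mean_value_le f (df : R -> V) (a b C : R) : a <= b ->
  (forall t, is_derive t 1 f (df t)) ->
  (forall t, a <= t <= b -> `|df t| <= C) -> `|f b - f a| <= C * (b - a).
Proof.
move=> ab fdf dfC; pose y := f b - f a.
have phi t : is_derive t 1 (fun s => dot (f s) y) (dot (df t) y).
  have := is_derive_dot (fdf t) (is_derive_cst y t 1).
  by rewrite -(scale0r 0) dotZr mul0r addr0.
have cphi : {within `[a, b], continuous (fun s => dot (f s) y)}.
  by apply: derivable_within_continuous => t _; case: (phi t).
have [c cab] := MVT_segment ab (fun t _ => phi t) cphi.
rewrite -dotNl -(dotDl ip) -/y (dotE ip) => yE.
have [y0|y0] := eqVneq y 0.
  rewrite y0 normr0 mulr_ge0 ?subr_ge0//.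
  by apply: le_trans (dfC a _) => //; rewrite lexx.
rewrite -(ler_pM2r (_ : 0 < `|y|)) ?normr_gt0// -expr2 yE mulrAC.
rewrite ler_wpM2r ?subr_ge0//; apply: le_trans (dot_le _ _) _.
by rewrite ler_wpM2r// dfC// (itvP cab).
Qed.

(** The energy estimate: [exp (-2 mu t) |f t|^2] has the derivative
    [2 exp (-2 mu t) (<f', f> - mu |f|^2) <= 0]. Only a bound on [<f', f>] is
    needed, whereas Gronwall's inequality would ask for one on [|f'|]. *)
Lemma one_sided_growth f (df : R -> V) (mu : R) :
  (forall t, 0 < t -> is_derive t 1 f (df t)) -> f t @[t --> 0^'+] --> f 0 ->
  (forall t, 0 < t -> dot (df t) (f t) <= mu * `|f t| ^+ 2) ->
  forall t, 0 <= t -> `|f t| <= expR (mu * t) * `|f 0|.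
Proof.
move=> fdf f0 hmu t t0.
pose phi (s : R) := expR (- (2 * mu) * s) * dot (f s) (f s).
pose dphi (s : R) := expR (- (2 * mu) * s) *
  (2 * (dot (df s) (f s) - mu * dot (f s) (f s))).
have phiE (s : R) : 0 < s -> is_derive s 1 phi (dphi s).
  move=> s0; have fs := fdf s s0.
  have ds := is_derive_dot fs fs.
  have es : is_derive s 1 (fun r => expR (- (2 * mu) * r))
      (expR (- (2 * mu) * s) * - (2 * mu)).
    apply: (@is_derive1_comp _ expR (fun r => - (2 * mu) * r)).
    have := @is_deriveZ R R R id (- (2 * mu)) s 1 1 (is_derive_id s (1 : R)).
    by rewrite [_ *: _]mulr1.
  apply: (is_derive_eq (is_deriveM es ds)).
  by rewrite /dphi (dotC ip (f s)) /GRing.scale /=; ring.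
have [/eqP t00|tN0] := boolP (t == 0).
  by rewrite t00 mulr0 expR0 mul1r.
have {tN0}t0' : 0 < t by rewrite lt_neqAle eq_sym tN0.
have [||c /andP[c0 ct]] := @MVT _ phi dphi 0 t t0'.
- by move=> s; rewrite in_itv/= => /andP[s0 _]; exact: phiE.
- apply/continuous_within_itvP => //; split.
  + move=> s; rewrite in_itv/= => /andP[s0 _].
    exact: is_derive1_continuous (phiE s s0).
  + apply: cvgM; last exact: cvg_dot.
    apply: cvg_at_right_filter; apply: continuous_comp.
      exact: mulrl_continuous.
    exact: continuous_expR.
  + apply: cvg_at_left_filter; exact: is_derive1_continuous (phiE t t0').
rewrite subr0 => phiB.
have : phi t <= phi 0.
  rewrite -subr_le0 phiB pmulr_lle0// /dphi pmulr_rle0 ?expR_gt0//.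
  by rewrite pmulr_rle0// subr_le0 (dotE ip) hmu.
rewrite /phi mulr0 expR0 mul1r !(dotE ip) mulNr expRN mulrC ler_pdivrMr ?expR_gt0//.
rewrite mulrC (_ : expR _ = expR (mu * t) ^+ 2).
  by rewrite -exprMn ler_pXn2r ?nnegrE ?mulr_ge0 ?expR_ge0.
by rewrite -expRM_natl; congr expR; ring.
Qed.

(** Taylor's formula for a sequence of successive derivatives, by induction on
    the order: the remainder of order [k + 1] of [f 0] vanishes at [r = 0] and
    has the remainder of order [k] of [f 1] as derivative. Bounding [s^k] by
    [r^k] instead of integrating it loses the factor [1 / k!], which leaves the
    constant [1]. *)
Lemma taylor_le (k : nat) : forall (f : nat -> R -> V) (t tau K : R),
  (forall i (r : R), is_derive r 1 (f i) (f i.+1 r)) ->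
  (forall r, t <= r <= t + tau -> `|f k r| <= K) ->
  forall r, 0 <= r <= tau ->
  `|f 0%N (r + t) - \sum_(i < k) (r ^+ i / i`!%:R) *: f i t| <= K * r ^+ k.
Proof.
elim: k => [|k IH] f t tau K fdf fK r /andP[r0 rtau].
  by rewrite big_ord0 subr0 mulr1 fK// lerDr r0 /= addrC lerD2l.
pose g (s : R) : V := f 0%N (s + t) - \sum_(i < k.+1) (s ^+ i / i`!%:R) *: f i t.
pose dg (s : R) : V := f 1%N (s + t) - \sum_(i < k) (s ^+ i / i`!%:R) *: f i.+1 t.
have gdg (s : R) : is_derive s 1 g (dg s).
  apply: is_deriveB; first by apply: is_derive1_shift.
  have ds (i : 'I_k.+1) : is_derive s 1 (fun r : R => (r ^+ i / i`!%:R) *: f i t)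
      ((i%:R * s ^+ i.-1 / i`!%:R) *: f i t).
    apply: is_derive_scalel.
    have := is_deriveZ i`!%:R^-1 (is_deriveX i (is_derive_id s (1 : R))).
    rewrite scaler1 [_ *: (i%:R * _)]mulrC; congr is_derive; apply/funext => x.
    by rewrite exprfctE mulrC.
  have := is_derive_sum ds; rewrite fct_sumE => dsum; apply: is_derive_eq dsum _.
  rewrite big_ord_recl /= mul0r mul0r scale0r add0r.
  apply: eq_bigr => i _; rewrite /bump /= add1n factS natrM invfM.
  by rewrite mulrACA mulfV ?mul1r// pnatr_eq0.
have g0 : g 0 = 0.
  rewrite /g add0r big_ord_recl /= big1 ?addr0; last first.
    by move=> i _; rewrite /bump /= add1n expr0n mul0r scale0r.
  by rewrite fact0 divr1 scale1r subrr.
have := mean_value_le r0 gdg (C := K * r ^+ k).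
rewrite g0 !subr0 -mulrA -exprSr; apply=> s /andP[s0 sr].
have srtau : 0 <= s <= tau by rewrite s0 (le_trans sr).
apply: le_trans (IH (fun i => f i.+1) _ _ _ _ fK s srtau) _ => //.
have K0 : 0 <= K.
  apply: le_trans (normr_ge0 _) (fK t _).
  by rewrite lexx lerDl (le_trans r0).
by rewrite ler_wpM2l// lerXn2r ?nnegrE.
Qed.

End calculus.

(** * Existence of semidiscrete solutions *)

Section exponential_generating_function.
Context {R : realType}.
Implicit Types (a : nat -> R) (t B C : R).

(** The exponential generating function of [a]; its derivative is that of the
    shifted sequence, so a linear recurrence on sequences becomes a linear
    differential equation. *)
Definition egf a t : R := limn (pseries (fun i => a i / i`!%:R) t).

Lemma is_cvg_egf a B C : 0 <= B -> (forall i, `|a i| <= C * B ^+ i) ->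
  forall t, cvgn (pseries (fun i => a i / i`!%:R) t).
Proof.
move=> B0 aB t; apply: normed_cvg.
have C0 : 0 <= C by have := aB 0%N; rewrite mulr1; exact: le_trans.
have cE : cvgn (series (C *: exp_coeff (B * `|t|))).
  by apply: is_cvg_seriesZ; exact: is_cvg_series_exp_coeff.
apply: series_le_cvg cE => i.
- exact: normr_ge0.
- by rewrite /= mulr_ge0// divr_ge0// exprn_ge0// mulr_ge0.
- rewrite -[X in _ <= X]/(C * ((B * `|t|) ^+ i / i`!%:R)).
  rewrite exprMn /= !normrM normrX normfV normr_nat !mulrA mulrAC.
  by rewrite ler_wpM2r ?invr_ge0// ler_wpM2r// exprn_ge0.
Qed.

Lemma is_derive_egf a B C : 0 <= B -> (forall i, `|a i| <= C * B ^+ i) ->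
  forall t, is_derive t 1 (egf a) (egf (fun i => a i.+1) t).
Proof.
move=> B0 aB t.
have diffsE b : pseries_diffs (fun i => b i / i`!%:R) =
    (fun i => b i.+1 / i`!%:R : R).
  apply/funext => i; rewrite /pseries_diffs factS natrM invfM mulrCA.
  by rewrite mulVKf.
have a1B i : `|a i.+1| <= C * B * B ^+ i by rewrite -mulrA -exprS.
have a2B i : `|a i.+2| <= C * B * B * B ^+ i by rewrite -2!mulrA -!exprS.
rewrite /egf -(diffsE a).
apply: (@pseries_snd_diffs _ _ (`|t| + 1)); rewrite ?diffsE.
- exact: is_cvg_egf aB _.
- exact: is_cvg_egf a1B _.
- exact: is_cvg_egf a2B _.
- by rewrite [ltRHS]ger0_norm ?ltrDl// addr_ge0.
Qed.

Lemma egf0 a : egf a 0 = a 0%N.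
Proof.
apply: lim_near_cst => //; near=> n.
have -> : n = n.-1.+1 by rewrite prednK//; near: n; exact: nbhs_infty_gt.
rewrite /pseries /series /= big_nat_recl//= big1 => [|i _].
  by rewrite fact0 divr1 mulr1 addr0.
by rewrite expr0n mulr0.
Unshelve. all: by end_near. Qed.

Lemma egf_sum (n : nat) (a : 'I_n -> nat -> R) (x : 'I_n -> R) B C : 0 <= B ->
  (forall l i, `|a l i| <= C * B ^+ i) -> forall t,
  egf (fun i => \sum_l a l i * x l) t = \sum_l egf (a l) t * x l.
Proof.
move=> B0 aB t; apply: cvg_lim => //.
rewrite (_ : pseries _ _ =
    fun N => \sum_l pseries (fun i => a l i / i`!%:R) t N * x l); last first.
  apply/funext => N; rewrite /pseries /series /=.
  under [RHS]eq_bigr do rewrite mulr_suml.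
  rewrite exchange_big /=; apply: eq_bigr => i _.
  by rewrite !mulr_suml; apply: eq_bigr => l _; ring.
apply: cvg_big => [|l _]; first exact: add_continuous.
apply: cvgM; last exact: cvg_cst.
exact: is_cvg_egf (aB l) _.
Qed.

End exponential_generating_function.

Section flow.
Context {R : realType} {V : normedModType R} {S : {pred V}} {W : subLmodType S}.
Variable L : {linear W -> W}.

Lemma val_scale (c : R) (w : W) : \val (c *: w) = c *: \val w.
Proof. exact: linearZ. Qed.

(** The curve [exp (t L) v]. If [A] represents [L] on a generating family [b],
    the rows [a k] of coordinates of [L^k v] satisfy [a (k + 1) = a k * A], hence
    grow at most geometrically, and the generating functions of their entries
    are coordinates of the curve. As the family may be
    dependent, coordinates are chosen once for [v] and for each [L (b l)]. The
    conclusion covers all [L^k y] because these are at the same time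
    semidiscrete solutions and the successive derivatives of [y]. *)
Lemma exists_flow (v : W) : finite_dimensional W ->
  exists2 y : R -> W, y 0 = v & forall k (t : R),
    is_derive t 1 (fun r => \val (iter k L (y r))) (\val (iter k.+1 L (y t))).
Proof.
move=> [n [b bW]].
have /choice[A AE] : forall l, exists c : 'I_n -> R,
  L (b l) = \sum_(j < n) c j *: b j by move=> l; exact: bW.
have [c cE] := bW v.
pose step (x : 'I_n -> R) j := \sum_l x l * A l j.
pose a k := iter k step c.
pose B := \sum_l \sum_j `|A l j|.
pose C := \sum_j `|c j|.
have B0 : 0 <= B by do 2!apply: sumr_ge0 => ? _.
have aB k j : `|a k j| <= C * B ^+ k.
  elim: k j => [|k IH] j.
    by rewrite mulr1 /C (bigD1 j)//= lerDl sumr_ge0.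
  rewrite /a iterS -/(a k) /step (le_trans (ler_norm_sum _ _ _))//.
  rewrite exprSr mulrA /B mulr_sumr; apply: ler_sum => l _.
  rewrite normrM ler_pM// (bigD1 j)//= lerDl sumr_ge0//.
(* The coordinates of L^k y are the generating functions of the shifted rows. *)
pose Y k j : R -> R := egf (fun i => a (k + i)%N j).
have YB k j i : `|a (k + i)%N j| <= C * B ^+ k * B ^+ i.
  by rewrite -mulrA -exprD.
pose y t := \sum_j Y 0%N j t *: b j.
have iterE k t : iter k L (y t) = \sum_j Y k j t *: b j.
  elim: k => [//|k IH]; rewrite iterS IH linear_sum /=.
  under eq_bigr do rewrite linearZ /= AE scaler_sumr.
  rewrite exchange_big /=; apply: eq_bigr => j _.
  under eq_bigr do rewrite scalerA.
  rewrite -scaler_suml; congr (_ *: _).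
  by rewrite -(egf_sum _ B0 (YB k)).
exists y => [|k t].
  by rewrite /y cE; apply: eq_bigr => j _; rewrite /Y egf0.
rewrite iterE.
rewrite (_ : (fun r => _) = fun r => \sum_j Y k j r *: \val (b j)); last first.
  apply/funext => r; rewrite iterE raddf_sum; apply: eq_bigr => j _.
  exact: val_scale.
rewrite raddf_sum.
have dY j : is_derive t 1 (fun r => Y k j r *: \val (b j)) (\val (Y k.+1 j t *: b j)).
  rewrite val_scale; apply: is_derive_scalel.
  have -> : Y k.+1 j = egf (fun i => a (k + i.+1)%N j).
    by congr egf; apply/funext => i; rewrite addSnnS.
  exact: is_derive_egf B0 (YB k j) _.
by have := is_derive_sum dY; rewrite fct_sumE.
Qed.

End flow.

(** * Operators on the discrete space *)

Section operators.
Context {R : realType} {V : normedModType R} {S : {pred V}} {W : subLmodType S}.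
Implicit Types (w : W).

(** Scaling a vector to the unit ball recovers the pointwise bound from the
    operator norm. The factor [r] keeps the bound meaningful for an extended-real
    norm, so finiteness need not be settled first. *)
Lemma le_opnorm (A : W -> W) (r c : R) : (forall a w, A (a *: w) = a *: A w) ->
  0 < r -> (r%:E * opnorm A <= c%:E)%E ->
  forall w, r * `|\val (A w)| <= c * `|\val w|.
Proof.
move=> homA r0 rc w; have [w0|w0] := eqVneq (\val w) 0.
  have -> : w = 0 by apply: val_inj; rewrite w0 raddf0.
  by rewrite -(scale0r 0) homA !scale0r raddf0 normr0 !mulr0.
have n0 : 0 < `|\val w| by rewrite normr_gt0.
rewrite -ler_pdivrMr// -lee_fin; apply: le_trans rc.
rewrite -mulrA EFinM lee_pmul2l// ?lte_fin//.
apply: ereal_sup_ubound; exists (`|\val w|^-1 *: w) => /=.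
  by rewrite val_scale normrZ normfV normr_id mulVf// gt_eqF.
by rewrite homA val_scale normrZ normfV normr_id mulrC.
Qed.

Variable L : {linear W -> W}.

Lemma iter_linearZ k a w : iter k L (a *: w) = a *: iter k L w.
Proof. by elim: k => //= k ->; rewrite linearZ. Qed.

Lemma iter_linearB k w w' : iter k L (w - w') = iter k L w - iter k L w'.
Proof. by elim: k => //= k ->; rewrite linearB. Qed.

Variables (alpha : nat -> R) (s : nat) (tau : R).

Lemma rk_opE w : rk_op alpha s tau L w =
  \sum_(i < s.+1) (alpha i * tau ^+ i) *: iter i L w.
Proof.
apply: eq_bigr => i _; rewrite -scalerA; congr (_ *: _).
elim: (i : nat) => [|k IH]; first by rewrite scale1r.
by rewrite iterS IH linearZ scalerA -exprS.
Qed.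

Lemma rk_opZ a w : rk_op alpha s tau L (a *: w) = a *: rk_op alpha s tau L w.
Proof.
rewrite !rk_opE scaler_sumr; apply: eq_bigr => i _.
by rewrite iter_linearZ !scalerA mulrC.
Qed.

Lemma rk_opB w w' : rk_op alpha s tau L (w - w') =
  rk_op alpha s tau L w - rk_op alpha s tau L w'.
Proof.
rewrite !rk_opE -sumrB; apply: eq_bigr => i _.
by rewrite iter_linearB scalerBr.
Qed.

End operators.

(** * Stability and consistency *)

Section schemes.
Context {R : realType} {V : normedModType R} {dot : V -> V -> R}.
Hypothesis ip : inner_product dot.
Context {S : {pred V}} {W : subLmodType S}.
Variable L : {linear W -> W}.
Implicit Types (w : W).

Lemma semidiscrete_stability (mu : R) (z : R -> W) :
  (forall w, dot (\val (L w)) (\val w) <= mu * `|\val w| ^+ 2) ->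
  (forall t : R, 0 < t -> is_derive t 1 (fun r => \val (z r)) (\val (L (z t)))) ->
  \val (z t) @[t --> 0^'+] --> \val (z 0) ->
  forall t : R, 0 <= t -> `|\val (z t)| <= expR (mu * t) * `|\val (z 0)|.
Proof. by move=> Lmu dz z0; apply: (one_sided_growth ip dz z0) => t _. Qed.

Variable y : R -> W.
Hypothesis dy : forall k (t : R),
  is_derive t 1 (fun r => \val (iter k L (y r))) (\val (iter k.+1 L (y t))).

Lemma flow_stability (mu : R) k :
  (forall w, dot (\val (L w)) (\val w) <= mu * `|\val w| ^+ 2) ->
  forall t r : R, 0 <= r ->
  `|\val (iter k L (y (r + t)))| <= expR (mu * r) * `|\val (iter k L (y t))|.
Proof.
move=> Lmu t r r0.
have dz (q : R) : is_derive q 1 (fun r => \val (iter k L (y (r + t))))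
    (\val (L (iter k L (y (q + t))))).
  apply: (@is_derive1_shift _ _ (fun r => \val (iter k L (y r)))); exact: dy.
have := @semidiscrete_stability mu (fun r => iter k L (y (r + t))) Lmu.
rewrite add0r; apply => //; apply: cvg_at_right_filter.
by have := is_derive1_continuous (dz 0); rewrite add0r.
Qed.

Variables (p s : nat) (alpha : nat -> R) (tau : R).
Hypothesis tau0 : 0 < tau.
Hypothesis Ltau : forall w, tau * `|\val (L w)| <= `|\val w|.

Lemma iter_bounded k w : tau ^+ k * `|\val (iter k L w)| <= `|\val w|.
Proof.
elim: k => [|k IH]; first by rewrite mul1r.
apply: le_trans IH; rewrite exprSr -mulrA.
by rewrite ler_wpM2l ?Ltau// exprn_ge0// ltW.
Qed.

(** Here [tau |L| <= 1] is used as the one-sided bound with [mu = 1 / tau]; it is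
    the source of the constant [e] in the error estimate. *)
Lemma flow_growth_one_step k (t r : R) : 0 <= r <= tau ->
  `|\val (iter k L (y (r + t)))| <= expR 1 * `|\val (iter k L (y t))|.
Proof.
move=> /andP[r0 rtau].
have Lmu w : dot (\val (L w)) (\val w) <= tau^-1 * `|\val w| ^+ 2.
  apply: le_trans (dot_le ip _ _) _.
  by rewrite expr2 mulrA ler_wpM2r// -ler_pdivrMl ?invr_gt0// invrK Ltau.
apply: le_trans (flow_stability k Lmu t r0) _.
by rewrite ler_wpM2r// ler_expR mulrC ler_pdivrMr// mul1r.
Qed.

Hypothesis alpha_exp : forall i, (i <= p)%N -> alpha i = i`!%:R^-1.
Hypothesis alpha0 : forall i, (s < i)%N -> alpha i = 0.

(** Otherwise the order conditions would give [alpha_p] the two values [1 / p!]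
    and [0]. *)
Lemma rk_stages : (p <= s)%N.
Proof.
rewrite leqNgt; apply/negP => /alpha0 => /eqP.
by rewrite alpha_exp// invr_eq0 pnatr_eq0 -leqn0 leqNgt fact_gt0.
Qed.

(** The stages [i <= p] cancel the Taylor polynomial of [y]. In a stage
    [i > p], the powers of [tau L] beyond the first [p + 1] have norm at most 1. *)
Lemma rk_consistency (t : R) : `|\val (y (tau + t) - rk_op alpha s tau L (y t))| <=
  (expR 1 + \sum_(p.+1 <= i < s.+1) `|alpha i|) *
    `|\val (iter p.+1 L (y t))| * tau ^+ p.+1.
Proof.
have ps := rk_stages.
set c := `|\val (iter p.+1 L (y t))|.
rewrite raddfB /= rk_opE raddf_sum /=.
rewrite -(big_mkord xpredT
  (fun i => \val ((alpha i * tau ^+ i) *: iter i L (y t)))).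
rewrite (@big_cat_nat _ _ _ p.+1)//= opprD addrA big_mkord.
apply: le_trans (ler_normB _ _) _.
rewrite -mulrA mulrDl lerD//.
  rewrite mulrA.
  have yc r : t <= r <= t + tau -> `|\val (iter p.+1 L (y r))| <= expR 1 * c.
    move=> /andP[tr rt]; rewrite -[r](subrK t).
    by rewrite flow_growth_one_step// subr_ge0 tr lerBlDl.
  have tt : 0 <= tau <= tau by rewrite lexx ltW.
  have := taylor_le ip dy yc tt; rewrite (_ : \sum_(i < p.+1) _ =
    \sum_(i < p.+1) \val ((alpha i * tau ^+ i) *: iter i L (y t)))//.
  apply: eq_bigr => i _.
  by rewrite val_scale alpha_exp 1?mulrC// -ltnS.
rewrite mulr_suml; apply: le_trans (ler_norm_sum _ _ _) _.
rewrite [leLHS]big_nat_cond [leRHS]big_nat_cond.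
apply: ler_sum => i /andP[/andP[pi _] _].
rewrite val_scale normrZ normrM -mulrA ler_wpM2l//.
rewrite normrX gtr0_norm// -(subnK pi) exprD mulrAC ler_wpM2r//.
  by rewrite exprn_ge0// ltW.
by rewrite iterD iter_bounded.
Qed.

(** Each defect made before time [t^n] is carried to [t^n] by at most the factor
    [exp (max mu mu_h * t^n)]: growth of [L^(p+1) y] up to the time of the defect,
    growth of the scheme afterwards. *)
Lemma rk_convergence (mu mu_h : R) (v : nat -> W) : 0 <= mu -> 0 <= mu_h ->
  (forall w, dot (\val (L w)) (\val w) <= mu * `|\val w| ^+ 2) ->
  (forall w, `|\val (rk_op alpha s tau L w)| <= (1 + mu_h * tau) * `|\val w|) ->
  v 0%N = y 0 -> (forall n, v n.+1 = rk_op alpha s tau L (v n)) ->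
  forall n, `|\val (y (n%:R * tau) - v n)| <=
    expR (Num.max mu mu_h * (n%:R * tau)) *
      (`|\val (iter p.+1 L (y 0))| *
        (expR 1 + \sum_(p.+1 <= i < s.+1) `|alpha i|) *
        (n%:R * tau) * tau ^+ p).
Proof.
move=> mu0 muh0 Lmu rk_le v0 vS; set c := `|_|; set K := expR 1 + _.
set M := Num.max mu mu_h.
have K0 : 0 <= K by rewrite addr_ge0 ?expR_ge0// sumr_ge0.
have t0 n : 0 <= n%:R * tau by rewrite mulr_ge0// ltW.
have tS n : n.+1%:R * tau = tau + n%:R * tau by rewrite -natr1; ring.
elim=> [|n IH].
  by rewrite v0 mulr0n mul0r subrr raddf0 normr0 !(mulr0, mul0r).
rewrite tS vS; set t := n%:R * tau in IH *.
have eS : y (tau + t) - rk_op alpha s tau L (v n) =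
    (y (tau + t) - rk_op alpha s tau L (y t)) + rk_op alpha s tau L (y t - v n).
  by rewrite rk_opB addrA subrK.
rewrite eS raddfD; apply: le_trans (ler_normD _ _) _.
have c_le : `|\val (iter p.+1 L (y t))| <= expR (M * (tau + t)) * c.
  rewrite -[t in X in X <= _]addr0.
  apply: le_trans (flow_stability p.+1 Lmu 0 (t0 n)) _.
  rewrite ler_wpM2r// ler_expR ler_pM ?t0//; first by rewrite le_max lexx.
  by rewrite lerDr ltW.
have growth : 1 + mu_h * tau <= expR (M * tau).
  apply: le_trans (expR_ge1Dx _) _.
  by rewrite ler_expR ler_wpM2r ?le_max ?lexx ?orbT// ltW.
have step1 := le_trans (rk_consistency t) (_ : _ <= expR (M * (tau + t)) *
  (c * K * tau * tau ^+ p)).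
have step2 : `|\val (rk_op alpha s tau L (y t - v n))| <=
    expR (M * (tau + t)) * (c * K * t * tau ^+ p).
  apply: le_trans (rk_le _) _; rewrite mulrDr expRD -mulrA.
  by apply: ler_pM => //; rewrite addr_ge0// mulr_ge0// ltW.
rewrite [leRHS](_ : _ = expR (M * (tau + t)) * (c * K * tau * tau ^+ p) +
  expR (M * (tau + t)) * (c * K * t * tau ^+ p)); last by ring.
apply: lerD step2; apply: step1.
rewrite [leRHS](_ : _ = K * (expR (M * (tau + t)) * c) * tau ^+ p.+1).
  by rewrite ler_wpM2r ?exprn_ge0 ?(ltW tau0)// ler_wpM2l.
by rewrite exprS; ring.
Qed.

End schemes.

(** * The error estimate *)

(** The energy estimate for [uh - y] and the convergence of the scheme to [y]
    share the initial value [v 0] of [y]. *)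
Lemma fully_discrete_error {R : realType} {V : normedModType R}
    {dot : V -> V -> R} (ip : inner_product dot) {S : {pred V}}
    {W : subLmodType S} (L : {linear W -> W}) (uh : R -> W) (v : nat -> W)
    (p s : nat) (alpha : nat -> R) (tau mu mu_h : R) :
  finite_dimensional W ->
  (forall t : R, 0 < t -> is_derive t 1 (fun r => \val (uh r)) (\val (L (uh t)))) ->
  \val (uh t) @[t --> 0^'+] --> \val (uh 0) ->
  0 < tau -> (forall w, tau * `|\val (L w)| <= `|\val w|) ->
  (forall i, (i <= p)%N -> alpha i = i`!%:R^-1) ->
  (forall i, (s < i)%N -> alpha i = 0) ->
  0 <= mu -> 0 <= mu_h ->
  (forall w, dot (\val (L w)) (\val w) <= mu * `|\val w| ^+ 2) ->
  (forall w, `|\val (rk_op alpha s tau L w)| <= (1 + mu_h * tau) * `|\val w|) ->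
  (forall n, v n.+1 = rk_op alpha s tau L (v n)) ->
  forall n, `|\val (uh (n%:R * tau)) - \val (v n)| <=
    expR (Num.max mu mu_h * (n%:R * tau)) *
      (`|\val (uh 0) - \val (v 0%N)| +
       `|\val (iter p.+1 L (v 0%N))| *
        (expR 1 + \sum_(p.+1 <= i < s.+1) `|alpha i|) *
        (n%:R * tau) * tau ^+ p).
Proof.
move=> fdW duh uh0 tau0 Ltau alpha_exp alpha0 mu0 muh0 Lmu rk_le vS n.
have [y y0 dy] := exists_flow L (v 0%N) fdW.
set t := n%:R * tau; have t0 : 0 <= t by rewrite mulr_ge0// ltW.
rewrite -(subrK (\val (y t)) (\val (uh t))) -addrA.
apply: le_trans (ler_normD _ _) _; rewrite mulrDr; apply: lerD.
  rewrite -y0 -!raddfB.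
  have Le z : (fun r => \val (uh r - z r)) = (fun r => \val (uh r) - \val (z r)).
    by apply/funext => r; rewrite raddfB.
  apply: le_trans (semidiscrete_stability ip (z := fun t => uh t - y t) Lmu _ _ t0) _.
  - move=> r r0; rewrite linearB raddfB Le; apply: is_deriveB; first exact: duh.
    exact: (dy 0%N r).
  - rewrite Le raddfB; apply: cvgB => //; apply: cvg_at_right_filter.
    exact: (is_derive1_continuous (dy 0%N 0)).
  - by rewrite ler_wpM2r// ler_expR ler_wpM2r// le_max lexx.
have := rk_convergence ip dy tau0 Ltau alpha_exp alpha0 mu0 muh0 Lmu rk_le
  (esym y0) vS n.
by rewrite y0 raddfB.
Qed.

(** The bound [1 + x <= exp x] at [x = a t]; in [rk_convergence] the defects are
    added up with the plain factor [t]. *)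
Lemma le_growth_sigma {R : realType} (a t : R) : t <= growth_sigma a t.
Proof.
rewrite /growth_sigma; case: ifPn => // a0.
by rewrite ler_pdivlMr// lerBrDl mulrC expR_ge1Dx.
Qed.

Lemma L2_inner_product {R : realType} {disp} {T : measurableType disp}
  (nu : {measure set T -> \bar R}) (m : nat) :
  @inner_product R (L2 nu m) (@L2_dot _ _ _ nu m).
Proof.
split.
- exact: L2_dotDl.
- exact: L2_dotZl.
- exact: L2_dotC.
- by move=> u; rewrite L2_normE sqr_sqrtr// L2_dot_ge0.
Qed.

Theorem theorem5p1 (R : realType) (d m : nat)
  (Omega : set 'rV[R]_d) (oOmega : open Omega)
  (* the operator L and the exact solution u, with u(t) in L^2(Omega; R^m) *)
  (q : nat) (a : {ffun 'I_d -> 'I_q.+1} -> 'rV[R]_d -> 'M[R]_m)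
  (u : 'rV[R]_d -> R -> 'cV[R]_m)
  (hu : exact_solution Omega (diff_op a) u)
  (ut : R -> L2 (lebesgue_on oOmega) m)
  (hut : forall t, 0 <= t -> L2_represents (ut t) (u ^~ t))
  (* the finite-dimensional subspace Vh and the operators Lh, Pi *)
  (S : {pred L2 (lebesgue_on oOmega) m}) (Vh : subLmodType S)
  (hVh : finite_dimensional Vh)
  (Lh : {linear Vh -> Vh})
  (k : nat) (dom : set ('rV[R]_d -> 'cV[R]_m))
  (Pi : ('rV[R]_d -> 'cV[R]_m) -> Vh)
  (hPi : smooth_linear_operator Omega k dom Pi)
  (* the semidiscrete scheme *)
  (uh : R -> Vh)
  (huh : forall t, 0 <= t ->
    time_derivable (fun r => \val (uh r)) t /\
    time_derive (fun r => \val (uh r)) t = \val (Lh (uh t)))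
  (* the fully discrete scheme *)
  (p s : nat) (alpha : nat -> R) (tau lambda : R)
  (htau0 : 0 < tau) (htau1 : tau <= 1)
  (hCFL : (tau%:E * opnorm Lh <= lambda%:E)%E) (hlambda : lambda < 1)
  (unh : nat -> Vh)
  (hunh : forall n, unh n.+1 = rk_op alpha s tau Lh (unh n))
  (hunh0 : unh 0%N = Pi (u ^~ 0))
  (* (R) *)
  (hR : regular_solution oOmega q p (diff_op a) dom Pi u)
  (* (SB) *)
  (mu : R) (hmu : 0 <= mu)
  (hSB : forall vh : Vh,
    L2_dot (\val (Lh vh)) (\val vh) <= mu * `|\val vh| ^+ 2)
  (* (FS) *)
  (mu_h : R) (hmu_h : 0 <= mu_h)
  (hFS : forall r : R, 0 < r -> (r%:E * opnorm Lh <= lambda%:E)%E ->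
    (opnorm (rk_op alpha s r Lh) <= (1 + mu_h * r)%:E)%E)
  (* (RK) *)
  (hp : (1 <= p)%N)
  (halpha : forall i, (i <= p)%N -> alpha i = (i`!%:R)^-1)
  (halphap : alpha p.+1 != (p.+1`!%:R)^-1)
  (halphas : forall i, (s < i)%N -> alpha i = 0)
  (* (M) *)
  (h : R) (E : R -> R -> R)
  (hE : forall t, 0 <= t -> `|ut t - \val (uh t)| <= E t h)
  (C_Pi : R)
  (hC : `|\val (iter p.+1 Lh (Pi (u ^~ 0)))| <= C_Pi) :
  forall n : nat,
    let tn := n%:R * tau in
    let C_star := C_Pi * (expR 1 + \sum_(p.+1 <= i < s.+1) `|alpha i|)
                  * growth_sigma mu_h tn in
    `|ut tn - \val (unh n)| <=
      expR (Num.max mu mu_h * tn) *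
        (`|\val (uh 0) - \val (Pi (u ^~ 0))|
         + `|\val (Pi (u ^~ 0)) - \val (unh 0%N)| + C_star * tau ^+ p)
      + E tn h.
Proof.
move=> n; cbv zeta; set tn := n%:R * tau; set C_star := _ * growth_sigma _ _.
have tn0 : 0 <= tn by rewrite mulr_ge0// ltW.
have Ltau w : tau * `|\val (Lh w)| <= `|\val w|.
  apply: le_trans (le_opnorm (iter_linearZ Lh 1) htau0 hCFL w) _.
  by rewrite ler_piMl// ltW.
have rk_le w : `|\val (rk_op alpha s tau Lh w)| <= (1 + mu_h * tau) * `|\val w|.
  rewrite -[leLHS]mul1r; apply: le_opnorm => //; first exact: rk_opZ.
  by rewrite mul1e hFS.
have full := fully_discrete_error (L2_inner_product (lebesgue_on oOmega) m) hVh
  (fun t t0 => time_derive_is_derive1 t0 (huh t (ltW t0)))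
  (time_derive_cvg0 (huh 0 (lexx 0))) htau0 Ltau halpha halphas hmu hmu_h hSB
  rk_le hunh n.
apply: le_trans (ler_distD (\val (uh tn)) _ _) _; rewrite addrC.
apply: lerD (hE tn tn0); apply: le_trans full _; rewrite hunh0 subrr normr0 addr0.
have K0 : 0 <= expR 1 + \sum_(p.+1 <= i < s.+1) `|alpha i|.
  by rewrite addr_ge0 ?expR_ge0// sumr_ge0.
rewrite ler_wpM2l ?expR_ge0// lerD2l ler_wpM2r ?exprn_ge0 ?(ltW htau0)//.
apply: ler_pM => //; first by rewrite mulr_ge0.
- by rewrite ler_wpM2r.
- exact: le_growth_sigma.
Qed.
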